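(* Let $f$ be an arbitrary arithmetic function. Then for all positive integers $k$ and $n$, $$\sum_{\substack{1\le a_1,\ldots, a_k\le n \\ (a_1\cdots a_k,n)=1 \\ (a_1+\cdots+a_k,n)=1}} f\big((a_1+\cdots +a_k-1,\,n)\big) = \varphi_k(n)\sum_{d\mid n} \frac{(\mu * f)(d)}{\varphi(d)}.$$
   Context: An arithmetic function is a function from the positive integers to $\mathbb{C}$. $(a,b)$ denotes the greatest common divisor (with $(0,n)=n$), $\varphi$ is Euler's totient function, $\mu$ is the Möbius function, and $*$ is Dirichlet convolution, $(\mu*f)(d)=\sum_{e\mid d}\mu(e)f(d/e)$. The sum on the left is over ordered $k$-tuples of integers satisfying the indicated conditions. For positive integers $k,n$, $\varphi_k(n)$ denotes the number of ordered $k$-tuples of integers $(a_1,\ldots,a_k)$ with $1\le a_1,\ldots,a_k\le n$ such that $(a_1\cdots a_k,n)=1$ and $(a_1+\cdots+a_k,n)=1$. *)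

(* Defs.v *)
From mathcomp Require Import all_boot all_order all_algebra.
From mathcomp Require Import reals.
From mathcomp Require Import complex.

Set Implicit Arguments.
Unset Strict Implicit.
Unset Printing Implicit Defensive.

Import GRing.Theory Num.Theory.
Local Open Scope ring_scope.

(* An arithmetic function is represented by a function on nat; its value at 0
   carries no meaning, and nothing below ever evaluates it at 0 when n > 0. *)

Definition mobius (n : nat) : int :=
  if all (fun p => ~~ (p ^ 2 %| n)%N) (primes n)
  then (-1) ^+ size (primes n) else 0.

Definition dirichlet_conv (A : pzSemiRingType) (f g : nat -> A) (n : nat) : A :=
  \sum_(d <- divisors n) f d * g (n %/ d)%N.

(* The integers 1 <= a_i <= n are elements of 'I_n.+1 with 0 excluded by the
   first condition. *)
Definition unit_sum_tuples (k n : nat) : {set {ffun 'I_k -> 'I_n.+1}} :=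
  [set a : {ffun 'I_k -> 'I_n.+1} |
    [&& [forall i, (1 <= a i)%N],
        coprime (\prod_(i < k) a i)%N n
      & coprime (\sum_(i < k) a i)%N n]].

Definition phi_k (k n : nat) : nat := #|unit_sum_tuples k n|.

(* Main.v *)
Require Import Defs.
From mathcomp Require Import all_boot all_order all_algebra.
From mathcomp Require Import cyclic.
From mathcomp Require Import reals.
From mathcomp Require Import complex.

Import GRing.Theory Num.Theory.
Local Open Scope ring_scope.

(** Since f = 1 * (mu * f), each summand is a sum of (mu * f)(d) over the
    divisors d of n for which the tuple sum is congruent to 1 mod d
    ([mobius_inversion]).  Exchanging the two summations, the identity reduces
    to a count for each d dividing n: the admissible tuples whose sum is 1 mod d
    are exactly the fraction 1 / phi(d) of all admissible tuples
    ([totient_mul_card_sum_fiber]).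

    For this count, the sum of an admissible tuple is a unit mod d, so it takes
    one of phi(d) values, and each value is taken equally often.  Indeed, units
    mod d lift to units mod n ([coprime_lift]), and multiplying all entries of a
    tuple by a unit u mod n is an injection on admissible tuples that multiplies
    the sum by u; choosing u suitably carries any unit value of the sum mod d to
    any other ([card_sum_fiber_le]).

    Möbius inversion itself rests on the vanishing of the sum of mu over the
    divisors of n > 1 ([sum_mobius_divisors]): for a prime p dividing n, the
    divisors e prime to p cancel against the divisors p e, and mu kills the
    divisors that p^2 divides. *)

(** * Sums over divisors *)

Lemma big_divisors_dvd {V : nmodType} {m d : nat} (F : nat -> V) :
    (0 < m)%N -> (d %| m)%N ->
  \sum_(g <- divisors d) F g = \sum_(g <- divisors m | (g %| d)%N) F g.
Proof.
move=> m_gt0 d_m; have d_gt0 := dvdn_gt0 m_gt0 d_m.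
rewrite -[RHS]big_filter; apply/perm_big/uniq_perm; rewrite ?filter_uniq ?divisors_uniq //.
move=> g; rewrite mem_filter -!dvdn_divisors //.
by case: (boolP (g %| d)%N) => // g_d; rewrite (dvdn_trans g_d d_m).
Qed.

Lemma big_divisors_multiples {V : nmodType} {m g : nat} (F : nat -> V) :
    (0 < m)%N -> (g %| m)%N ->
  \sum_(d <- divisors m | (g %| d)%N) F d
  = \sum_(h <- divisors (m %/ g)) F (g * h)%N.
Proof.
move=> m_gt0 g_m; have g_gt0 := dvdn_gt0 m_gt0 g_m.
have q_gt0 : (0 < m %/ g)%N by rewrite divn_gt0 // dvdn_leq.
rewrite -big_filter -(big_map (muln g) xpredT F).
apply/perm_big/uniq_perm; first by rewrite filter_uniq ?divisors_uniq.
  rewrite map_inj_uniq ?divisors_uniq // => x y /eqP.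
  by rewrite eqn_pmul2l // => /eqP.
move=> d; rewrite mem_filter -dvdn_divisors //; apply/andP/mapP.
  case=> /dvdnP[h ->] hg_m; exists h; last by rewrite mulnC.
  by rewrite -dvdn_divisors // dvdn_divRL.
by case=> h; rewrite -dvdn_divisors // dvdn_divRL // mulnC => hg_m ->; rewrite dvdn_mulr.
Qed.

Lemma big_divisors_rev {V : nmodType} {d : nat} (F : nat -> V) : (0 < d)%N ->
  \sum_(e <- divisors d) F e = \sum_(e <- divisors d) F (d %/ e)%N.
Proof.
move=> d_gt0; rewrite -[RHS](big_map (divn d) xpredT F).
have divK e : (e %| d)%N -> (d %/ (d %/ e))%N = e.
  by move=> e_d; rewrite divnA // mulKn.
have div_dvd e : (e %| d)%N -> (d %/ e %| d)%N.
  by move=> e_d; apply/dvdnP; exists e; rewrite mulnC divnK.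
apply/perm_big/uniq_perm; first exact: divisors_uniq.
  rewrite map_inj_in_uniq ?divisors_uniq // => x y.
  by rewrite -!dvdn_divisors // => x_d y_d eq_xy; rewrite -(divK x) // eq_xy divK.
move=> e; rewrite -dvdn_divisors //; apply/idP/mapP.
  by move=> e_d; exists (d %/ e)%N; rewrite ?divK // -dvdn_divisors // div_dvd.
by case=> h; rewrite -dvdn_divisors // => h_d ->; apply: div_dvd.
Qed.

(** * Möbius inversion *)

Lemma mobius_prime_mul {p e : nat} : prime p -> (0 < e)%N -> ~~ (p %| e)%N ->
  mobius (p * e) = - mobius e.
Proof.
move=> p_pr e_gt0 pNe.
have primes_pe : perm_eq (primes (p * e)) (p :: primes e).
  apply: uniq_perm; rewrite /= ?primes_uniq ?andbT //.
    by rewrite mem_primes p_pr e_gt0 (negPf pNe).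
  by move=> q; rewrite primesM ?(prime_gt0 p_pr) // (primes_prime p_pr) !inE.
rewrite /mobius (perm_all _ primes_pe) (perm_size primes_pe) /=.
have -> : ~~ (p ^ 2 %| p * e)%N.
  by rewrite expnS expn1 dvdn_pmul2l ?prime_gt0.
rewrite /= (@eq_in_all _ _ (fun q => ~~ (q ^ 2 %| e)%N)); last first.
  move=> q; rewrite mem_primes => /and3P[q_pr _ q_e].
  rewrite Gauss_dvdr // coprimeXl // prime_coprime // dvdn_prime2 //.
  by apply: contraNneq pNe => <-.
by case: ifP => _; rewrite ?oppr0 // exprS mulN1r.
Qed.

Lemma mobius_square {p e : nat} : prime p -> (0 < e)%N -> (p %| e)%N ->
  mobius (p * e) = 0.
Proof.
move=> p_pr e_gt0 p_e; rewrite /mobius ifN //.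
apply/allPn; exists p; last by rewrite negbK expnS expn1 dvdn_mul.
by rewrite primesM ?(prime_gt0 p_pr) // (primes_prime p_pr) inE eqxx.
Qed.

(** A smallest prime divisor p of n pairs each divisor e prime to p with p e,
    and mu takes opposite values on the two.  The remaining divisors are p e
    with p dividing e, where mu vanishes. *)
Lemma sum_mobius_divisors {n : nat} : (0 < n)%N ->
  \sum_(d <- divisors n) mobius d = (n == 1)%:R.
Proof.
move=> n_gt0; case: eqVneq => [-> | n_neq1].
  by rewrite (_ : divisors 1 = [:: 1%N]) // big_seq1.
have p_pr : prime (pdiv n) by rewrite pdiv_prime // ltn_neqAle eq_sym n_neq1.
move: (pdiv n) p_pr (pdiv_dvd n) => p p_pr p_n.
have q_gt0 : (0 < n %/ p)%N by rewrite divn_gt0 ?prime_gt0 // dvdn_leq.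
rewrite (bigID (fun d => p %| d)%N) /= (big_divisors_multiples _ n_gt0 p_n).
rewrite (bigID (fun d => p %| d)%N) /= big_seq_cond big1 ?add0r; last first.
  move=> e /andP[]; rewrite -dvdn_divisors // => e_q p_e.
  by rewrite mobius_square // (dvdn_gt0 q_gt0).
rewrite big_seq_cond (eq_bigr (fun e => - mobius e)); last first.
  move=> e /andP[]; rewrite -dvdn_divisors // => e_q pNe.
  by rewrite mobius_prime_mul // (dvdn_gt0 q_gt0).
rewrite -big_seq_cond sumrN.
(* A divisor of n prime to p already divides n / p. *)
suff -> : \sum_(e <- divisors (n %/ p) | ~~ (p %| e)%N) mobius e
        = \sum_(e <- divisors n | ~~ (p %| e)%N) mobius e by rewrite addNr.
rewrite -big_filter -[RHS]big_filter.
apply/perm_big/uniq_perm; rewrite ?filter_uniq ?divisors_uniq // => e.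
rewrite !mem_filter -!dvdn_divisors //; case: (boolP (p %| e)%N) => //= pNe.
rewrite -[in RHS](divnK p_n) Gauss_dvdl //.
by rewrite coprime_sym prime_coprime.
Qed.

(** Collecting the terms by g = d / e turns the coefficient of f(g) into the sum
    of mu over the divisors of m / g, which is nonzero only for g = m. *)
Lemma mobius_inversion {A : comPzRingType} (f : nat -> A) {m : nat} : (0 < m)%N ->
  \sum_(d <- divisors m) dirichlet_conv (fun e => (mobius e)%:~R) f d = f m.
Proof.
move=> m_gt0.
transitivity (\sum_(d <- divisors m) \sum_(g <- divisors m | (g %| d)%N)
                (mobius (d %/ g))%:~R * f g).
  rewrite big_seq [RHS]big_seq; apply: eq_bigr => d; rewrite -dvdn_divisors // => d_m.
  have d_gt0 := dvdn_gt0 m_gt0 d_m.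
  rewrite /dirichlet_conv big_divisors_rev // -big_divisors_dvd //.
  rewrite big_seq [RHS]big_seq; apply: eq_bigr => g; rewrite -dvdn_divisors // => g_d.
  by rewrite divnA // mulKn.
rewrite (exchange_big_dep xpredT) //=.
rewrite (bigD1_seq m) ?divisors_uniq -?dvdn_divisors //=.
have inner g : (g %| m)%N ->
    \sum_(d <- divisors m | (g %| d)%N) (mobius (d %/ g))%:~R * f g
    = (m == g)%:R * f g.
  move=> g_m; have g_gt0 := dvdn_gt0 m_gt0 g_m.
  have q_gt0 : (0 < m %/ g)%N by rewrite divn_gt0 // dvdn_leq.
  rewrite big_divisors_multiples // -mulr_suml.
  rewrite (eq_bigr (fun h => (mobius h)%:~R)); last by move=> h _; rewrite mulKn.
  rewrite -(rmorph_sum (intr : int -> A)) sum_mobius_divisors //.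
  rewrite -(eqn_pmul2r g_gt0) divnK // mul1n.
  by rewrite rmorph_nat.
rewrite inner // eqxx mul1r big_seq_cond big1 ?addr0 // => g /andP[].
by rewrite -dvdn_divisors // => g_m gNm; rewrite inner // eq_sym (negPf gNm) mul0r.
Qed.

(** * Units modulo a divisor of n *)

(** The Chinese remainder theorem is applied to d and the largest divisor of n
    prime to d: together they contain all the primes of n. *)
Lemma coprime_lift {d n r : nat} : (0 < n)%N -> (d %| n)%N -> coprime r d ->
  exists2 u, coprime u n & u = r %[mod d].
Proof.
move=> n_gt0 d_n co_rd; have d_gt0 := dvdn_gt0 n_gt0 d_n.
pose m := (n`_(\pi(d)^'))%N.
have co_dm : coprime d m by rewrite (pnat_coprime (pnat_pi d_gt0)) // part_pnat.
have m_gt0 : (0 < m)%N by rewrite part_gt0.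
(* The multiple of d m only serves to make the representative positive. *)
pose u := (d * m + chinese d m r 1)%N.
have u_gt0 : (0 < u)%N by rewrite addn_gt0 muln_gt0 d_gt0 m_gt0.
have u_d : u = r %[mod d] by rewrite /u mulnC modnMDl chinese_modl.
have u_m : u = 1 %[mod m] by rewrite /u modnMDl chinese_modr.
exists u => //.
have co_ud : coprime u d by rewrite -coprime_modl u_d coprime_modl.
have co_um : coprime u m by rewrite -coprime_modl u_m coprime_modl coprime1n.
rewrite -(partnC \pi(d) n_gt0) coprimeMr co_um andbT coprime_sym.
by rewrite (pnat_coprime (part_pnat _ _)) // -coprime_pi' // coprime_sym.
Qed.

Lemma coprime_lift_ratio {d n r s : nat} : (0 < n)%N -> (d %| n)%N ->
    coprime r d -> coprime s d ->
  exists2 u, coprime u n & u * r = s %[mod d].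
Proof.
move=> n_gt0 d_n co_rd co_sd; have d_gt0 := dvdn_gt0 n_gt0 d_n.
(* By Euler's theorem this power of r is its inverse modulo d. *)
pose r' := (r ^ (totient d).-1)%N.
have r'r : r' * r = 1 %[mod d].
  by rewrite /r' -expnSr prednK ?totient_gt0 // Euler_exp_totient.
have co_sr' : coprime (s * r') d by rewrite coprimeMl co_sd coprimeXl.
have [u co_un u_d] := coprime_lift n_gt0 d_n co_sr'; exists u => //.
by rewrite -modnMml u_d modnMml -mulnA -modnMmr r'r modnMmr muln1.
Qed.

(** * Scaling tuples by a unit *)

(** The representative of x modulo n among 1, ..., n; the summand n.-1 offsets
    the final successor without requiring x > 0. *)
Definition pos_residue (n x : nat) : nat := ((x + n.-1) %% n).+1.

Lemma pos_residue_lt {n : nat} (x : nat) : (0 < n)%N -> (pos_residue n x < n.+1)%N.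
Proof. by move=> n_gt0; rewrite ltnS ltn_pmod. Qed.

Lemma pos_residue_mod {n : nat} (x : nat) : (0 < n)%N ->
  pos_residue n x = x %[mod n].
Proof.
by move=> n_gt0; rewrite /pos_residue -addn1 modnDml -addnA addn1 prednK // modnDr.
Qed.

Lemma eq_mod_pos {n x y : nat} : (0 < x <= n)%N -> (0 < y <= n)%N ->
  x = y %[mod n] -> x = y.
Proof.
case: x y => [|x] [|y] //= x_lt y_lt /eqP.
by rewrite -[x.+1]addn1 -[y.+1]addn1 eqn_modDr !modn_small // => /eqP ->.
Qed.

Definition scale_tuple {k n : nat} (u : nat) (a : {ffun 'I_k -> 'I_n.+1}) :
    {ffun 'I_k -> 'I_n.+1} :=
  [ffun i => inord (pos_residue n (u * a i))].

Lemma scale_tupleE {k n : nat} (u : nat) (a : {ffun 'I_k -> 'I_n.+1}) i :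
  (0 < n)%N -> scale_tuple u a i = pos_residue n (u * a i) :> nat.
Proof. by move=> n_gt0; rewrite ffunE inordK // pos_residue_lt. Qed.

Lemma sum_scale_tuple {k n : nat} (u : nat) (a : {ffun 'I_k -> 'I_n.+1}) :
  (0 < n)%N ->
  \sum_(i < k) scale_tuple u a i = u * \sum_(i < k) a i %[mod n].
Proof.
move=> n_gt0; rewrite big_distrr /= -modn_summ -[RHS]modn_summ; congr (_ %% _)%N.
by apply: eq_bigr => i _; rewrite scale_tupleE // pos_residue_mod.
Qed.

Lemma coprime_prodl {I : finType} (n : nat) (F : I -> nat) :
  coprime (\prod_i F i) n = [forall i, coprime (F i) n].
Proof.
by rewrite (big_morph (coprime^~ n) (coprimeMl n) (coprime1n n)) big_andE.
Qed.

Lemma scale_unit_sum_tuple {k n u : nat} {a : {ffun 'I_k -> 'I_n.+1}} :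
    (0 < n)%N -> coprime u n -> a \in unit_sum_tuples k n ->
  scale_tuple u a \in unit_sum_tuples k n.
Proof.
move=> n_gt0 co_un; rewrite !inE => /and3P[a_gt0 co_prod co_sum].
apply/and3P; split.
- by apply/forallP => i; rewrite scale_tupleE.
- rewrite !(coprime_prodl n) in co_prod *; apply/forallP => i.
  rewrite scale_tupleE // -coprime_modl pos_residue_mod // coprime_modl.
  by rewrite coprimeMl co_un (forallP co_prod).
- by rewrite -coprime_modl sum_scale_tuple // coprime_modl coprimeMl co_un.
Qed.

(** Scaling by an inverse of u modulo n recovers each entry modulo n, hence
    exactly, since the entries lie in 1, ..., n. *)
Lemma scale_tuple_inj {k n u : nat} : (0 < n)%N -> coprime u n ->
  {in unit_sum_tuples k n &, injective (scale_tuple u)}.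
Proof.
move=> n_gt0 co_un a b; rewrite !inE => /and3P[/forallP a_gt0 _ _].
move=> /and3P[/forallP b_gt0 _ _] /ffunP eq_ab; apply/ffunP => i; apply/val_inj.
have le_n (c : 'I_n.+1) : (0 < c)%N -> (0 < c <= n)%N by move=> ->; rewrite -ltnS /=.
apply: (@eq_mod_pos n); [exact/le_n/a_gt0 | exact/le_n/b_gt0 |].
have [v _ vu1] := coprime_lift_ratio n_gt0 (dvdnn n) co_un (coprime1n n).
have /(congr1 (modn^~ n)) := congr1 (@nat_of_ord _) (eq_ab i).
rewrite !scale_tupleE // !pos_residue_mod // => /(congr1 (fun x => v * x %% n)%N).
by rewrite !modnMmr !mulnA -![(v * u * _ %% n)%N]modnMml vu1 !modnMml !mul1n.
Qed.

(** * Equidistribution of the sums *)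

Definition sum_fiber (k n d r : nat) : {set {ffun 'I_k -> 'I_n.+1}} :=
  [set a in unit_sum_tuples k n | \sum_(i < k) a i == r %[mod d]].

(** Scaling by a unit u modulo n with u r = s modulo d embeds one fibre into the
    other.  As r and s play symmetric roles, all fibres over units have the same
    cardinality. *)
Lemma card_sum_fiber_le {k n d r s : nat} : (0 < n)%N -> (d %| n)%N ->
    coprime r d -> coprime s d ->
  (#|sum_fiber k n d r| <= #|sum_fiber k n d s|)%N.
Proof.
move=> n_gt0 d_n co_rd co_sd.
have [u co_un ur_s] := coprime_lift_ratio n_gt0 d_n co_rd co_sd.
have fiber_sub r' : {subset sum_fiber k n d r' <= unit_sum_tuples k n}.
  by move=> a; rewrite inE => /andP[].
rewrite -(card_in_imset (f := scale_tuple u) (D := sum_fiber k n d r)); last first.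
  by move=> a b /fiber_sub Ua /fiber_sub Ub; apply: scale_tuple_inj.
apply/subset_leq_card/subsetP => _ /imsetP[a /[1!inE] /andP[Ua /eqP sum_a] ->].
rewrite inE scale_unit_sum_tuple //=; apply/eqP.
rewrite -[LHS](modn_dvdm _ d_n) sum_scale_tuple // modn_dvdm //.
by rewrite -modnMmr sum_a modnMmr.
Qed.

(** The sum of an admissible tuple is prime to n, hence to d, so the fibres over
    the phi(d) units modulo d partition the admissible tuples; these fibres are
    equally large.  The product form stays valid when there is no admissible
    tuple, as for n and k both even. *)
Lemma totient_mul_card_sum_fiber {k n d : nat} : (0 < n)%N -> (d %| n)%N ->
  (totient d * #|sum_fiber k n d 1|)%N = phi_k k n.
Proof.
move=> n_gt0 d_n; have d_gt0 := dvdn_gt0 n_gt0 d_n.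
pose residue (a : {ffun 'I_k -> 'I_n.+1}) : 'I_d :=
  Ordinal (ltn_pmod (\sum_(i < k) a i) d_gt0).
rewrite /phi_k -[RHS]sum1_card (partition_big residue (fun r => coprime d r)) /=; last first.
  move=> a; rewrite inE => /and3P[_ _ co_sum].
  by rewrite coprime_sym coprime_modl (coprime_dvdr d_n).
rewrite totient_count_coprime big_mkord big_distrl /= [RHS]big_mkcond /=.
apply: eq_bigr => r _; case: ifP => [co_dr|_]; last by rewrite mul0n.
rewrite mul1n (eq_bigl [in sum_fiber k n d r]) ?sum1_card.
  by apply/eqP; rewrite eqn_leq !card_sum_fiber_le ?coprime1n // coprime_sym.
by move=> a; rewrite !inE -val_eqE /= [(r %% d)%N]modn_small.
Qed.

(** * The identity *)

(** A tuple with at least one entry has a positive sum, so that the truncated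
    subtraction of 1 is the true one. *)
Lemma dvdn_gcd_sum_sub1 {k n d : nat} {a : {ffun 'I_k -> 'I_n.+1}} :
    (0 < k)%N -> (d %| n)%N -> a \in unit_sum_tuples k n ->
  (d %| gcdn (\sum_(i < k) a i - 1) n)%N = (a \in sum_fiber k n d 1).
Proof.
move=> k_gt0 d_n Ua; rewrite dvdn_gcd d_n andbT [in RHS]inE Ua /= eqn_mod_dvd //.
move: Ua; rewrite inE => /and3P[/forallP a_gt0 _ _].
by rewrite (bigD1 (Ordinal k_gt0)) //= ltn_addr // a_gt0.
Qed.

Lemma sum_unit_tuples_gcd {F : numFieldType} (f : nat -> F) {k n : nat} :
    (0 < k)%N -> (0 < n)%N ->
  \sum_(a in unit_sum_tuples k n) f (gcdn (\sum_(i < k) a i - 1) n)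
  = (phi_k k n)%:R *
    \sum_(d <- divisors n)
      dirichlet_conv (fun e => (mobius e)%:~R) f d / (totient d)%:R.
Proof.
move=> k_gt0 n_gt0; pose g := dirichlet_conv (fun e => (mobius e)%:~R) f.
transitivity (\sum_(a in unit_sum_tuples k n)
    \sum_(d <- divisors n | (d %| gcdn (\sum_(i < k) a i - 1) n)%N) g d).
  apply: eq_bigr => a _.
  by rewrite -(big_divisors_dvd _ n_gt0 (dvdn_gcdr _ _)) mobius_inversion // gcdn_gt0 n_gt0 orbT.
rewrite (exchange_big_dep xpredT) //= mulr_sumr big_seq [RHS]big_seq.
apply: eq_bigr => d; rewrite -dvdn_divisors // => d_n.
rewrite (eq_bigl [in sum_fiber k n d 1]); last first.
  move=> a; case: (boolP (a \in unit_sum_tuples k n)) => [Ua | Ua] /=.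
    by rewrite dvdn_gcd_sum_sub1.
  by rewrite inE (negPf Ua).
rewrite sumr_const -(totient_mul_card_sum_fiber n_gt0 d_n) natrM -/(g d).
have phi_neq0 : (totient d)%:R != 0 :> F.
  by rewrite pnatr_eq0 -lt0n totient_gt0 (dvdn_gt0 n_gt0 d_n).
by rewrite mulrCA mulrAC mulfV // mul1r mulr_natr.
Qed.

(* For k > 0 the sum of the a_i is at least 1, so the subtraction of naturals
   is not truncated. *)
Theorem theorem2p4 (R : realType) (f : nat -> R[i]) (k n : nat)
    (k_gt0 : (0 < k)%N) (n_gt0 : (0 < n)%N) :
  \sum_(a in unit_sum_tuples k n) f (gcdn ((\sum_(i < k) a i) - 1) n)
  = (phi_k k n)%:R *
    \sum_(d <- divisors n)
      dirichlet_conv (fun e => (mobius e)%:~R) f d / (totient d)%:R.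
Proof. exact: sum_unit_tuples_gcd. Qed.
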